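(* Let $\alpha>-1$, $\xi\le0$ and $M\ge0$. Let $c_1$ be the linear functional associated to the measure $\frac{x^{\alpha+1}}{x-\xi}e^{-x}dx+M\delta(\xi)$, where the first part is supported on $]0,+\infty[$. For $n\ge0$, the monic polynomial $T_{n+1}(t,\xi,M)$ of degree $n+1$ in $t$, orthogonal with respect to $c_1$, satisfies $$T_{n+1}(t,\xi,M)=-\frac{k_n^{\alpha+1}}{c_1(L_n^{\alpha+1}(x))}\Big(1-(t-\xi)\,c_1\big(N_n^{\alpha+1}(x,t)\big)\Big),$$ where $c_1$ acts on the variable $x$ and $$N_n^{\alpha+1}(x,t)=\sum_{j=0}^n\frac{L_j^{\alpha+1}(x)L_j^{\alpha+1}(t)}{k_j^{\alpha+1}}.$$
   Context: $\delta(\xi)$ is the Dirac measure at $\xi$, so $c_1(p)=\int_0^\infty p(x)\frac{x^{\alpha+1}}{x-\xi}e^{-x}dx+Mp(\xi)$. For $a>-1$, $L_n^{a}$ is the monic Laguerre-Sonin polynomial of degree $n$, orthogonal with respect to $x^{a}e^{-x}dx$ on $]0,+\infty[$, and $k_n^{a}=\int_0^\infty(L_n^{a}(x))^2x^{a}e^{-x}dx=n!\,\Gamma(n+a+1)$. *)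

(* Defs.v *)
From HB Require Import structures.
From mathcomp Require Import all_boot all_order all_algebra.
From mathcomp Require Import all_classical all_reals all_analysis.

Set Implicit Arguments.
Unset Strict Implicit.
Unset Printing Implicit Defensive.

Import Order.TTheory GRing.Theory Num.Theory.
Import numFieldNormedType.Exports.

Local Open Scope classical_set_scope.
Local Open Scope ring_scope.

Section OrthogonalPolynomials.
Variable R : realType.
Implicit Types (c : {poly R} -> R) (n : nat) (P : {poly R}).

(* [size P = n.+1] is degree n; [(size Q <= n)%N] is degree < n. *)
Definition is_monic_orthogonal c n P : Prop :=
  [/\ P \is monic, size P = n.+1
    & forall Q : {poly R}, (size Q <= n)%N -> c (P * Q) = 0].

(* The monic polynomial of degree n orthogonal with respect to c; the value is
   0 (which is not monic) if there is none. *)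
Definition monic_orthogonal c n : {poly R} :=
  xget 0 [set P : {poly R} | is_monic_orthogonal c n P].

End OrthogonalPolynomials.

Section LaguerreSonin.
Variable R : realType.
Implicit Types (a alpha xi M x t : R) (p : {poly R}) (n j : nat).

Definition laguerre_functional a p : R :=
  \int[lebesgue_measure]_(x in `]0, +oo[) (p.[x] * (x `^ a * expR (- x))).

(* The monic L_n^a, which is (-1)^n n! times the classical Laguerre polynomial. *)
Definition laguerre a n : {poly R} :=
  monic_orthogonal (laguerre_functional a) n.

(* k_n^a, the squared norm of L_n^a; for a > -1 it equals n! Gamma(n + a + 1). *)
Definition laguerre_sqnorm a n : R :=
  laguerre_functional a (laguerre a n ^+ 2).

(* The functional c_1 of the measure
   x^(alpha+1) / (x - xi) e^(-x) dx on ]0, +oo[ plus M delta(xi). *)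
Definition c1 alpha xi M p : R :=
  \int[lebesgue_measure]_(x in `]0, +oo[)
    (p.[x] * (x `^ (alpha + 1) / (x - xi) * expR (- x)))
  + M * p.[xi].

(* The kernel N_n^a(x, t), as a polynomial in x for a fixed value of t. *)
Definition laguerre_kernel a n t : {poly R} :=
  \sum_(j < n.+1) ((laguerre a j).[t] / laguerre_sqnorm a j) *: laguerre a j.

End LaguerreSonin.

(* Main.v *)
Require Import Defs.
From HB Require Import structures.
From mathcomp Require Import all_boot all_order all_algebra.
From mathcomp Require Import all_classical all_reals all_analysis.
From mathcomp Require Import measurable_realfun ring.

Import Order.TTheory GRing.Theory Num.Theory.
Import numFieldNormedType.Exports.

Local Open Scope classical_set_scope.
Local Open Scope ring_scope.

(** Write L for the Laguerre functional of parameter alpha + 1, with monic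
orthogonal polynomials L_j and squared norms k_j. The weight of c_1 is chosen so
that c_1((x - xi) p) = L(p). Let K = sum_(j <= n) c_1(L_j) / k_j L_j, which
is t |-> c_1(N_n(x, t)). By the reproducing property L(K q) = c_1(q) for all q
of degree at most n, so that c_1((1 - (x - xi) K) q) = c_1(q) - L(K q) = 0. The
factor in front makes the polynomial monic; c_1(L_n) <> 0 since otherwise L_n
would be c_1-orthogonal to all polynomials of degree at most n, hence to
itself. *)

(** * Orthogonal polynomials of a positive definite functional *)

Lemma scalar_eq0_size_le (R : realType) (f : {poly R} -> R)
    (P : nat -> {poly R}) (n : nat) (Q : {poly R}) :
  scalar f -> (forall j, (j < n)%N -> P j \is monic /\ size (P j) = j.+1) ->
  (forall j, (j < n)%N -> f (P j) = 0) -> (size Q <= n)%N -> f Q = 0.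
Proof.
move=> flin; have f0 : f 0 = 0.
  by have := flin (-1) 0 0; rewrite scaler0 addr0 mulN1r addNr.
elim: n Q => [|n IHn] Q basisP fP sQ.
  by move: sQ; rewrite leqn0 size_poly_eq0 => /eqP ->.
have [/monicP lP sP] := basisP n (ltnSn n).
have -> : Q = Q`_n *: P n + (Q - Q`_n *: P n) by rewrite addrC subrK.
rewrite flin fP // mulr0 add0r; apply: IHn.
- by move=> j jn; apply: basisP; exact: ltnW.
- by move=> j jn; apply: fP; exact: ltnW.
apply/leq_sizeP => j; rewrite leq_eqVlt => /predU1P[<-|nj].
  by move: lP; rewrite /lead_coef sP /= coefB coefZ => ->; rewrite mulr1 subrr.
rewrite coefB coefZ [Q`_j]nth_default ?(leq_trans sQ) //.
by rewrite [_`_j]nth_default ?sP // mulr0 subrr.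
Qed.

Section PositiveDefiniteFunctional.
Variables (R : realType) (c : {scalar {poly R}}).
Hypothesis c_gt0 : forall p : {poly R}, p != 0 -> 0 < c (p ^+ 2).

(** The leading terms cancel in [P - Q], so this difference is an admissible test polynomial for
    both [P] and [Q]; hence [c ((P - Q) ^+ 2) = 0]. *)
Lemma monic_orthogonal_unique (n : nat) (P Q : {poly R}) :
  is_monic_orthogonal c n P -> is_monic_orthogonal c n Q -> P = Q.
Proof.
move=> [/monicP mP sP oP] [/monicP mQ sQ oQ].
have sD : (size (P - Q)%R <= n)%N.
  apply/leq_sizeP => j; rewrite leq_eqVlt => /predU1P[<-|nj].
    by move: mP mQ; rewrite /lead_coef sP sQ /= coefB => -> ->; rewrite subrr.
  by rewrite coefB !nth_default ?subrr ?sP ?sQ.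
apply/eqP; rewrite -subr_eq0; apply/negPn/negP => /c_gt0.
by rewrite expr2 mulrBl linearB /= oP // oQ // subrr ltxx.
Qed.

(** Gram-Schmidt: subtract from ['X^n] its projections on the orthogonal polynomials of lower
    degree. *)
Lemma monic_orthogonal_exists (n : nat) :
  exists P : {poly R}, is_monic_orthogonal c n P.
Proof.
elim/ltn_ind: n => n IHn.
(* Existence below [n] ensures that [xget] does not return its default value 0 there. *)
have mo j : (j < n)%N -> is_monic_orthogonal c j (monic_orthogonal c j).
  by move=> /IHn [P]; exact: xgetI.
set p := monic_orthogonal c in mo.
pose S := \sum_(j < n) (c ('X^n * p j) / c (p j ^+ 2)) *: p j.
have sS : (size S <= n)%N.
  rewrite (leq_trans (size_sum _ _ _)) //; apply/bigmax_leqP => j _.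
  rewrite (leq_trans (size_scale_leq _ _)) //.
  by have [_ -> _] := mo j (ltn_ord j).
exists ('X^n - S); have sXS : (size (- S)%R < size ('X^n : {poly R}))%N.
  by rewrite size_polyN size_polyXn.
split.
- by apply/monicP; rewrite lead_coefDl // lead_coefXn.
- by rewrite size_polyDl // size_polyXn.
move=> Q; apply: (@scalar_eq0_size_le _ (fun Q => c (('X^n - S) * Q)) p).
- by move=> a u v /=; rewrite mulrDr -scalerAr linearP.
- by move=> j /mo [].
move=> j jn; have [mj sj oj] := mo j jn.
have pj0 : c (p j ^+ 2) != 0 by rewrite gt_eqF // c_gt0 // monic_neq0.
(* Only the term of index [j] of [S] survives, and it cancels [c ('X^n * p j)]. *)
rewrite mulrBl linearB /= mulr_suml linear_sum /= (bigD1 (Ordinal jn)) //=.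
rewrite -scalerAl linearZ /= -expr2 mulfVK // big1 ?addr0 ?subrr // => i neij.
rewrite -scalerAl linearZ /=; have [mi si oi] := mo i (ltn_ord i).
(* Of [p i] and [p j], the one of lower degree serves as test polynomial for the other. *)
have : (i : nat) != j by apply: contra neij => /eqP ij; apply/eqP/val_inj.
rewrite neq_ltn => /orP[ij|ji]; last by rewrite (oi (p j)) ?mulr0 ?sj.
by rewrite [p i * _]mulrC (oj (p i)) ?mulr0 ?si.
Qed.

Lemma monic_orthogonalP (n : nat) :
  is_monic_orthogonal c n (monic_orthogonal c n).
Proof. by have [P] := monic_orthogonal_exists n; exact: xgetI. Qed.

Lemma monic_orthogonalE (n : nat) (P : {poly R}) :
  is_monic_orthogonal c n P -> monic_orthogonal c n = P.
Proof. exact/monic_orthogonal_unique/monic_orthogonalP. Qed.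

Lemma monic_orthogonal_neq (i j : nat) : i != j ->
  c (monic_orthogonal c i * monic_orthogonal c j) = 0.
Proof.
have [_ si oi] := monic_orthogonalP i; have [_ sj oj] := monic_orthogonalP j.
by rewrite neq_ltn => /orP[ij|ji]; [rewrite mulrC oj ?si|rewrite oi ?sj].
Qed.

End PositiveDefiniteFunctional.

(** * The kernel formula for two functionals linked by the factor ['X - xi%:P] *)

Section ChristoffelUvarov.
Variables (R : realType) (c L : {scalar {poly R}}) (xi : R).
Hypothesis c_gt0 : forall p : {poly R}, p != 0 -> 0 < c (p ^+ 2).
Hypothesis L_gt0 : forall p : {poly R}, p != 0 -> 0 < L (p ^+ 2).
Hypothesis cL : forall p : {poly R}, c (('X - xi%:P) * p) = L p.

Let p := monic_orthogonal L.
Let k j := L (p j ^+ 2).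

Let pP n : is_monic_orthogonal L n (p n).
Proof. exact: monic_orthogonalP. Qed.

Let k_neq0 n : k n != 0.
Proof. by have [mp _ _] := pP n; rewrite gt_eqF // L_gt0 // monic_neq0. Qed.

(** Dividing [p n] by ['X - xi%:P] with quotient [q] gives [c (p n ^+ 2) = (p n).[xi] * c (p n) + L
    (p n * q)]. The last term is 0 since [size q <= n], while the left side is positive. *)
Lemma functional_monic_orthogonal_neq0 n : c (p n) != 0.
Proof.
have [mp sp op] := pP n; apply/eqP => cp0.
have : 0 < c (p n ^+ 2) by rewrite c_gt0 // monic_neq0.
(* Modulo [X - xi], the second factor of [p n * p n] is a constant. *)
have [q qE] : exists q, p n - (p n).[xi]%:P = q * ('X - xi%:P).
  by apply/factor_theorem; rewrite /root !hornerE subrr.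
have sq : (size q <= n)%N.
  have [->|q0] := eqVneq q 0; first by rewrite size_poly0.
  have := size_Mmonic q0 (monicXsubC xi).
  rewrite size_XsubC addn2 /= -qE -ltnS => <-.
  rewrite (leq_trans (size_polyD _ _)) // size_polyN geq_max sp leqnn /=.
  by rewrite (leq_trans (size_polyC_leq1 _)).
have pE : p n = (p n).[xi]%:P + ('X - xi%:P) * q.
  by rewrite [_ * q]mulrC -qE addrC subrK.
rewrite expr2 {2}pE mulrDr mulrCA linearD /= cL op // addr0 mulrC mul_polyC.
by rewrite linearZ /= cp0 mulr0 ltxx.
Qed.

Lemma monic_orthogonal_christoffel n :
  monic_orthogonal c n.+1 =
  - (k n / c (p n)) *:
    (1 - ('X - xi%:P) * \sum_(j < n.+1) (c (p j) / k j) *: p j).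
Proof.
have cn0 := functional_monic_orthogonal_neq0 n.
apply: monic_orthogonalE => //; set K := \sum_(j < _) _.
(* The reproducing property. On [q = p j] only the term [c (p j) / k j * L (p j ^+ 2) = c (p j)]
   remains. *)
have KL (q : {poly R}) : (size q <= n.+1)%N -> L (K * q) = c q.
  move=> sq; apply/eqP; rewrite -subr_eq0; apply/eqP.
  pose f (q : {poly R}) := L (K * q) - c q.
  apply: (@scalar_eq0_size_le _ f p n.+1) => //.
  - by move=> a u v; rewrite /f mulrDr -scalerAr (linearP L) (linearP c)
      /= mulrBr opprD addrACA.
  - by move=> j _; have [] := pP j.
  move=> j jn; rewrite /f /K mulr_suml linear_sum /= (bigD1 (Ordinal jn)) //=.
  rewrite -scalerAl linearZ /= -expr2 divfK ?k_neq0 //.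
  rewrite big1 ?addr0 ?subrr // => i neij.
  by rewrite -scalerAl linearZ /= monic_orthogonal_neq ?mulr0.
have [mpn spn _] := pP n.
(* The factor in front turns the term [j = n] of [K], times ['X - xi%:P], into exactly
   [('X - xi%:P) * p n], which is monic of degree [n.+1]. [S] collects the constant and the terms
   [j < n], of degree at most [n]. *)
pose S := (k n / c (p n)) *:
  (('X - xi%:P) * \sum_(j < n) (c (p j) / k j) *: p j - 1).
have TE : - (k n / c (p n)) *: (1 - ('X - xi%:P) * K) = ('X - xi%:P) * p n + S.
  have -> : ('X - xi%:P) * p n =
      (k n / c (p n)) *: (('X - xi%:P) * ((c (p n) / k n) *: p n)).
    by rewrite -scalerAr scalerA mulrA divfK // divff ?k_neq0 // scale1r.
  rewrite scaleNr -scalerN opprB /K big_ord_recr /= mulrDr -scalerDr.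
  by rewrite -addrA addrCA.
have sXp : size (('X - xi%:P) * p n) = n.+2.
  by rewrite size_monicM ?monicXsubC ?monic_neq0 // size_XsubC spn.
have sS : (size S <= n.+1)%N.
  rewrite (leq_trans (size_scale_leq _ _)) // (leq_trans (size_polyD _ _)) //.
  rewrite size_polyN size_poly1 geq_max andbT.
  rewrite (leq_trans (size_polyMleq _ _)) // size_XsubC addSn ltnS.
  rewrite (leq_trans (size_sum _ _ _)) //; apply/bigmax_leqP => j _.
  by rewrite (leq_trans (size_scale_leq _ _)) //; have [_ -> _] := pP j.
split.
- rewrite TE; apply/monicP; rewrite lead_coefDl ?sXp ?ltnS //.
  by rewrite lead_coefM lead_coefXsubC mul1r; exact/monicP.
- by rewrite TE size_polyDl sXp ?ltnS.
move=> q sq; rewrite -scalerAl linearZ /= mulrBl mul1r -mulrA linearB /= cL.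
by rewrite KL // subrr mulr0.
Qed.

End ChristoffelUvarov.

(** * Integrability of the weights on the open half-line *)

(** An exhaustion by compact intervals, on which the fundamental theorem of calculus applies.
    Starting at 2 keeps the first interval from degenerating to a point. *)
Lemma bigcup_itvcc_itvoy (R : realType) :
  (\bigcup_n `[n.+2%:R^-1, n.+2%:R] = `]0, +oo[ :> set R)%classic.
Proof.
apply/seteqP; split=> x /=.
  by move=> [n _]; rewrite /= !in_itv/= andbT => /andP[+ _]; exact: lt_le_trans.
(* A bound on [x + x^-1] bounds both [x] and [x^-1]. *)
rewrite in_itv/= andbT => x0; pose n := Num.truncn (x + x^-1).
have xn : x + x^-1 < n.+2%:R.
  by rewrite (lt_trans (truncnS_gt _)) // ltr_nat.
exists n => //=; rewrite in_itv/=; apply/andP; split.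
  rewrite invf_ple ?posrE // (le_trans _ (ltW xn)) // lerDr; exact: ltW.
by rewrite (le_trans _ (ltW xn)) // lerDl invr_ge0 ltW.
Qed.

(** On each compact interval of the exhaustion the integral is a difference of two values of [F],
    hence at most [C]; monotone convergence carries this bound to the half-line. *)
Lemma integrable_bounded_primitive (R : realType) (f F : R -> R) (C : R) :
  (forall x : R, 0 < x -> 0 <= f x) ->
  (forall x : R, 0 < x -> {for x, continuous f}) ->
  (forall x : R, 0 < x -> is_derive x 1 F (f x)) ->
  (forall x : R, 0 < x -> 0 <= F x <= C) ->
  lebesgue_measure.-integrable `]0, +oo[%classic (EFin \o f).
Proof.
move=> f0 fc dF FC; set mu := lebesgue_measure.
have mf : measurable_fun (`]0, +oo[%classic : set R) f.
  apply: open_continuous_measurable_fun => // x.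
  by rewrite inE/= in_itv/= andbT => /fc.
pose A n : set R := `[n.+2%:R^-1, n.+2%:R]%classic.
have A0 n x : A n x -> 0 < x.
  by rewrite /A/= in_itv/= => /andP[+ _]; apply: lt_le_trans.
have Fc (x : R) : 0 < x -> {for x, continuous F}.
  by move=> /dF [dFx _]; exact/differentiable_continuous/derivable1_diffP.
have intA n : (\int[mu]_(x in A n) (f x)%:E <= C%:E)%E.
  have n_gt1 : 1 < n.+2%:R :> R by rewrite ltr1n.
  have n0 : 0 < n.+2%:R^-1 :> R by rewrite invr_gt0 ltr0n.
  have nn : n.+2%:R^-1 < n.+2%:R :> R by rewrite (lt_trans _ n_gt1) // invf_lt1.
  rewrite (@continuous_FTC2 _ f F) //.
  - rewrite -EFinB lee_fin.
    have /andP[F0 _] := FC _ n0; have /andP[_ FC'] := FC _ (lt_trans n0 nn).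
    by rewrite lerBlDr (le_trans FC') // lerDl.
  - by apply: continuous_in_subspaceT => x; rewrite inE => /A0; exact: fc.
  - split.
    + move=> x; rewrite in_itv/= => /andP[nx _].
      by have [] := dF _ (lt_trans n0 nx).
    + by apply: cvg_at_right_filter; exact: Fc.
    + by apply: cvg_at_left_filter; apply: Fc; exact: lt_trans nn.
  - move=> x; rewrite in_itv/= => /andP[nx _]; rewrite derive1E.
    by have [] := dF _ (lt_trans n0 nx).
apply/integrableP; split; first exact/measurable_EFinP.
under eq_integral => x.
  rewrite inE/= in_itv/= andbT => x0.
  rewrite ger0_norm ?f0 //; over.
rewrite -bigcup_itvcc_itvoy.
have cvgA : (\int[mu]_(x in A n) (f x)%:E)%E @[n --> \oo]
    --> (\int[mu]_(x in \bigcup_n A n) (f x)%:E)%E.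
  apply: ge0_nondecreasing_set_cvg_integral.
  - apply/nondecreasing_seqP => n; rewrite subsetEset => x; rewrite /A/=.
    rewrite !in_itv/= => /andP[nx xn]; apply/andP; split.
      by rewrite (le_trans _ nx) // lef_pV2 ?posrE // ler_nat.
    by rewrite (le_trans xn) // ler_nat.
  - by move=> i; exact: measurable_itv.
  - move=> i; apply/measurable_EFinP.
    by apply: measurable_funS mf => // x /A0; rewrite /= in_itv/= andbT.
  - by move=> i x /A0 /f0; rewrite lee_fin.
rewrite (le_lt_trans _ (ltry C)) // -(cvg_lim _ cvgA) //.
by apply: lime_le; [exact: cvgP cvgA|exact: nearW].
Qed.

Lemma is_derive_divr1D (R : realType) (x : R) : 0 < x ->
  is_derive x 1 (fun y : R => y / (1 + y)) ((1 + x) ^- 2).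
Proof.
move=> x0; have x1 : 1 + x != 0 by rewrite gt_eqF // addr_gt0.
have dV : is_derive x (1 : R) (fun y : R => (1 + y)^-1)
    (- (1 + x) ^- 2 *: (0 + 1)).
  by apply: is_deriveV.
have := is_deriveM (is_derive_id x 1) dV.
by move/is_derive_eq; apply; rewrite /GRing.scale /=; field.
Qed.

(* The primitive (x / (1 + x))^(b + 1) is bounded, and its derivative dominates
   x^b e^(-x) up to a constant since (1 + x)^(b + 2) = O(e^x). *)
Lemma integrable_powR_expRN (R : realType) (b : R) : -1 < b ->
  lebesgue_measure.-integrable `]0, +oo[%classic
    (EFin \o (fun x : R => x `^ b * expR (- x))).
Proof.
move=> b1; have b0 : 0 < b + 1 by rewrite -ltrBlDr sub0r.
(* For negative [b] this is 0, and [b <= m.+1] still holds. *)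
pose m := Num.truncn b.
have bm : b <= m.+1%:R by rewrite ltW // truncnS_gt.
(* From [y^N / N! <= e^y] at [y = 1 + x] and [N = m + 3], so that [(1 + x)^(m + 3) <= K e^x]. Of the
   exponent, [m + 1] bounds [b] and 2 comes from the denominator of [g]. *)
pose K : R := m.+3`!%:R * expR 1.
pose g x : R := (b + 1) * (x / (1 + x)) `^ b * (1 + x) ^- 2.
have xx (x : R) : 0 < x -> 0 < x / (1 + x).
  by move=> x0; rewrite divr_gt0 // addr_gt0.
have intg : lebesgue_measure.-integrable `]0, +oo[%classic (EFin \o g).
  pose G (x : R) := (x / (1 + x)) `^ (b + 1).
  apply: (@integrable_bounded_primitive _ _ G 1).
  - by move=> x x0; rewrite /g !mulr_ge0 ?powR_ge0 ?invr_ge0 ?sqr_ge0 // ltW.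
  - move=> x x0; apply: continuousM.
      apply: continuousM; first exact: cst_continuous.
      have cu : {for x, continuous (fun y : R => y / (1 + y))}.
        have [du _] := is_derive_divr1D _ _ x0.
        exact/differentiable_continuous/derivable1_diffP.
      have cp : {for x / (1 + x), continuous (fun y : R => y `^ b)}.
        have [dp _] := is_derive1_powR b (xx _ x0).
        exact/differentiable_continuous/derivable1_diffP.
      exact: continuous_comp cu cp.
    apply: continuousV; first by rewrite expf_neq0 // gt_eqF // addr_gt0.
    have c1x : {for x, continuous (fun y : R => 1 + y)}.
      by apply: continuousD; [exact: cst_continuous|exact: cvg_id].
    exact: continuous_comp c1x (@exprn_continuous _ 2 _).
  - move=> x x0.
    have := @is_derive1_comp _ (fun y : R => y `^ (b + 1))
      (fun y : R => y / (1 + y)) _ _ _ (is_derive1_powR (b + 1) (xx _ x0))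
      (is_derive_divr1D _ _ x0).
    by rewrite addrK.
  - move=> x x0; rewrite powR_ge0 /=.
    apply: (@le_trans _ _ (1 `^ (b + 1))); last by rewrite powR1.
    rewrite ge0_ler_powR ?nnegrE ?ltW ?xx //.
    by rewrite ltr_pdivrMr ?mul1r ?ltrDr ?addr_gt0.
have intKg : lebesgue_measure.-integrable `]0, +oo[%classic
    (EFin \o (fun x => K / (b + 1) * g x)).
  exact: (integrableZl _ (K / (b + 1)) intg).
apply: le_integrable intKg => //.
  apply/measurable_EFinP/measurable_funM.
    by apply: measurable_funTS; exact: measurable_powR.
  by apply: measurableT_comp; [exact: measurable_expR|exact: measurable_funTS].
move=> x; rewrite /= in_itv/= andbT => x0; rewrite lee_fin.
have x10 : 0 < 1 + x by rewrite addr_gt0.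
have x11 : 1 <= 1 + x by rewrite lerDl ltW.
rewrite ger0_norm ?mulr_ge0 ?powR_ge0 ?expR_ge0 // ger0_norm; last first.
  by rewrite /g !mulr_ge0 ?invr_ge0 ?ler0n ?expR_ge0 ?powR_ge0 ?invr_ge0
    ?sqr_ge0 ?(ltW b0).
rewrite /g.
(* The first factor, which carries any singularity at 0, also occurs in [g]. For the second, the
   base is at least 1, so raising the exponent to [m.+1] only increases it, whatever the sign of
   [b]. *)
have -> : x `^ b = (x / (1 + x)) `^ b * (1 + x) `^ b.
  by rewrite -powRM ?divfK ?gt_eqF // ltW ?xx.
have h1 : (1 + x) `^ b <= (1 + x) ^+ m.+1.
  by rewrite -powR_mulrn ?ler_powR // ltW.
have h2 : (1 + x) ^+ m.+3 * expR (- x) <= K.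
  rewrite expRN ler_pdivrMr ?expR_gt0 // -mulrA -expRD.
  have := expR_ge1Dxn m.+2 (ltW x10).
  rewrite -(ler_pM2l (_ : 0 < m.+3`!%:R)) ?ltr0n ?fact_gt0 //; apply: le_trans.
  rewrite mulrDr mulr1 mulrCA divff ?mulr1 ?pnatr_eq0 -?lt0n ?fact_gt0 //.
  by rewrite lerDr ler0n.
have -> : K / (b + 1) * ((b + 1) * (x / (1 + x)) `^ b * (1 + x) ^- 2) =
   (x / (1 + x)) `^ b * (K * (1 + x) ^- 2).
  by field; rewrite !gt_eqF.
rewrite -mulrA ler_wpM2l ?powR_ge0 // ler_pdivlMr ?exprn_gt0 //.
apply: le_trans h2; rewrite mulrAC ler_wpM2r ?expR_ge0 //.
rewrite (_ : m.+3 = (m.+1 + 2)%N); last by rewrite addn2.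
by rewrite exprD ler_wpM2r ?exprn_ge0 // ltW.
Qed.

(** * Functionals given by a positive weight with finite moments *)

Lemma finite_set_root (R : realType) (p : {poly R}) : p != 0 ->
  finite_set [set x | root p x].
Proof.
move=> p0; apply: contrapT => /(infinite_set_fset (size p))[B Bp pB].
have /(max_poly_roots p0) : all (root p) (finmap.enum_fset B).
  by apply/allP => x /Bp.
by rewrite finmap.fset_uniq ltnNge pB => /(_ isT).
Qed.

Section PositiveWeight.
Variables (R : realType) (w : R -> R).
Let mu := (@lebesgue_measure R).
Let D : set R := `]0, +oo[.
Let mD : measurable D := measurable_itv _.
Hypothesis w_gt0 : forall x, 0 < x -> 0 < w x.
Hypothesis w_integrable : forall k : nat,
  mu.-integrable D (EFin \o (fun x => x ^+ k * w x)).

Lemma integrable_horner_weight (p : {poly R}) :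
  mu.-integrable D (EFin \o (fun x => p.[x] * w x)).
Proof.
have -> : EFin \o (fun x => p.[x] * w x) =
    (fun x => \sum_(i < size p) (p`_i)%:E * (x ^+ i * w x)%:E)%E.
  apply/funext => x /=; rewrite horner_coef mulr_suml sumEFin.
  by congr EFin; apply: eq_bigr => i _; rewrite mulrA.
by apply: integrable_sum => // i _; apply: integrableZl => //;
  exact: w_integrable.
Qed.

Lemma Rintegral_horner_weight_scalar :
  scalar (fun p : {poly R} => \int[mu]_(x in D) (p.[x] * w x)).
Proof.
move=> a p q; rewrite -RintegralZl //; last exact: integrable_horner_weight.
rewrite -RintegralD //; last 2 first.
- exact: (integrableZl _ a (integrable_horner_weight p)).
- exact: integrable_horner_weight.
by apply: eq_Rintegral => x _; rewrite hornerD hornerZ mulrDl mulrA.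
Qed.

(** A nonnegative integrand of integral 0 vanishes almost everywhere. As [w] is positive, this one
    vanishes only at the finitely many roots of [p], so the half-line would be a null set. *)
Lemma Rintegral_sqr_horner_weight_gt0 (p : {poly R}) : p != 0 ->
  0 < \int[mu]_(x in D) ((p ^+ 2).[x] * w x).
Proof.
move=> p0; have ip := integrable_horner_weight (p ^+ 2).
have pw0 x : D x -> 0 <= (p ^+ 2).[x] * w x.
  rewrite /D/= in_itv/= andbT => x0.
  by rewrite horner_exp mulr_ge0 ?sqr_ge0 // ltW // w_gt0.
rewrite lt_neqAle Rintegral_ge0 // andbT eq_sym; apply/eqP => I0.
have /ae_eq_integral_abs : (\int[mu]_(x in D) `|((p ^+ 2).[x] * w x)%:E| = 0)%E.
  under eq_integral => x /set_mem Dx do rewrite gee0_abs ?lee_fin ?pw0 //.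
  (* The real-valued integral is the [fine] of the extended one, hence 0 also for an infinite value;
     integrability excludes that case. *)
  rewrite -[LHS]fineK; last exact: integrable_fin_num.
  by congr EFin; exact: I0.
move=> /(_ mD) []; first by have /integrableP[] := ip.
move=> N [mN N0 DN].
have : mu.-negligible D.
  apply: (@negligibleS _ _ _ _ (N `|` [set x | root p x])).
    move=> x Dx /=; have [px|px] := boolP (root p x); [by right|left].
    apply: DN => /= /(_ Dx) [] /eqP; rewrite mulf_eq0 horner_exp expf_eq0 /=.
    rewrite -[_ == 0]/(root p x) (negPf px) /= gt_eqF // w_gt0 //.
    by move: Dx; rewrite /D/= in_itv/= andbT.
  apply: negligibleU; first by exists N; split.
  apply/negligibleP.
    apply: countable_measurable => [x|]; first exact: measurable_set1.
    exact/finite_set_countable/finite_set_root.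
  by apply/countable_lebesgue_measure0/finite_set_countable/finite_set_root.
move=> /(negligibleP mu mD) muD0; have : lebesgue_measure D = 0%E := muD0.
by rewrite lebesgue_measure_itv /= lt0y.

Qed.

End PositiveWeight.

(** * The Laguerre functional and [c1] as instances *)

Section LaguerreWeights.
Variables (R : realType) (alpha xi M : R).
Let mu := (@lebesgue_measure R).
Let D : set R := `]0, +oo[.
Let mD : measurable D := measurable_itv _.
Hypotheses (halpha : -1 < alpha) (hxi : xi <= 0) (hM : 0 <= M).

Lemma laguerre_weight_gt0 (a x : R) : 0 < x -> 0 < x `^ a * expR (- x).
Proof. by move=> x0; rewrite mulr_gt0 ?powR_gt0 ?expR_gt0. Qed.

(** The power [x ^+ k] is absorbed into the exponent, which becomes [a + k%:R > -1]. *)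
Lemma laguerre_weight_integrable (a : R) (k : nat) : -1 < a ->
  mu.-integrable D (EFin \o (fun x => x ^+ k * (x `^ a * expR (- x)))).
Proof.
move=> a1; have ak : -1 < a + k%:R by rewrite ltr_wpDr.
apply: eq_integrable (@integrable_powR_expRN _ _ ak) => // x.
rewrite inE /D/= in_itv/= andbT => x0.
have -> : x `^ (a + k%:R) = x `^ a * x ^+ k.
  by rewrite powRD ?(gt_eqF x0) ?implybT // powR_mulrn // ltW.
by rewrite mulrA [_ ^+ _ * _]mulrC.
Qed.

Let subxi_gt0 (x : R) : 0 < x -> 0 < x - xi.
Proof. by move=> x0; rewrite subr_gt0 (le_lt_trans hxi). Qed.

Lemma c1_weight_gt0 (x : R) : 0 < x ->
  0 < x `^ (alpha + 1) / (x - xi) * expR (- x).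
Proof.
by move=> x0; rewrite mulr_gt0 ?expR_gt0 // divr_gt0 ?powR_gt0 ?subxi_gt0.
Qed.

(** Since [xi <= 0], [x <= x - xi], so the weight is dominated by [x^alpha e^(-x)]. Here
    [alpha > -1] itself is needed, not just [alpha + 1 > -1]. *)
Lemma c1_weight_integrable (k : nat) :
  mu.-integrable D
    (EFin \o (fun x => x ^+ k * (x `^ (alpha + 1) / (x - xi) * expR (- x)))).
Proof.
apply: le_integrable (laguerre_weight_integrable _ k halpha) => //.
  apply/measurable_EFinP; apply: measurable_funM; first exact: measurable_funTS.
  apply: measurable_funM.
    apply: measurable_funM.
      by apply: measurable_funTS; exact: measurable_powR.
    apply: open_continuous_measurable_fun => // x.
    rewrite inE /D/= in_itv/= andbT => x0.
    have cV : {for x, continuous (fun y : R => (y - xi)^-1)}.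
      apply: continuousV; first by rewrite gt_eqF ?subxi_gt0.
      by apply: continuousB; [exact: cvg_id|exact: cst_continuous].
    exact: cV.
  by apply: measurableT_comp; [exact: measurable_expR|exact: measurable_funTS].
move=> x; rewrite /D/= in_itv/= andbT => x0; rewrite lee_fin.
rewrite ger0_norm; last by rewrite mulr_ge0 ?exprn_ge0 ?ltW ?c1_weight_gt0.
rewrite ger0_norm; last first.
  by rewrite mulr_ge0 ?exprn_ge0 ?ltW ?laguerre_weight_gt0.
rewrite ler_wpM2l ?exprn_ge0 ?(ltW x0) // ler_wpM2r ?expR_ge0 //.
rewrite ler_pdivrMr ?subxi_gt0 //.
have -> : x `^ (alpha + 1) = x `^ alpha * x.
  by rewrite powRD ?(gt_eqF x0) ?implybT // powRr1 // ltW.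
by rewrite ler_wpM2l ?powR_ge0 // lerDl oppr_ge0.
Qed.

Lemma laguerre_functional_scalar (a : R) : -1 < a ->
  scalar (laguerre_functional a).
Proof.
by move=> a1; apply: Rintegral_horner_weight_scalar => k;
  exact: laguerre_weight_integrable.
Qed.

Lemma laguerre_functional_gt0 (a : R) (p : {poly R}) : -1 < a -> p != 0 ->
  0 < laguerre_functional a (p ^+ 2).
Proof.
move=> a1; pose w (x : R) := x `^ a * expR (- x).
apply: (@Rintegral_sqr_horner_weight_gt0 _ w) => [x|k].
  exact: laguerre_weight_gt0.
exact: laguerre_weight_integrable.
Qed.

Lemma c1_scalar : scalar (c1 alpha xi M).
Proof.
move=> a p q; rewrite /c1.
rewrite (Rintegral_horner_weight_scalar _ _ c1_weight_integrable a p q).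
by rewrite hornerD hornerZ; ring.
Qed.

(** The point mass adds [M * p.[xi] ^+ 2 >= 0] to an integral that is already positive. *)
Lemma c1_gt0 (p : {poly R}) : p != 0 -> 0 < c1 alpha xi M (p ^+ 2).
Proof.
move=> p0; rewrite /c1 ltr_wpDr ?mulr_ge0 ?horner_exp ?sqr_ge0 //.
apply: Rintegral_sqr_horner_weight_gt0 => //; first exact: c1_weight_gt0.
exact: c1_weight_integrable.
Qed.

(** The factor cancels the denominator of the weight and vanishes at the point mass. *)
Lemma c1_mulXsubC (p : {poly R}) :
  c1 alpha xi M (('X - xi%:P) * p) = laguerre_functional (alpha + 1) p.
Proof.
rewrite /c1 hornerM hornerXsubC subrr mul0r mulr0 addr0.
apply: eq_Rintegral => x; rewrite inE/= in_itv/= andbT => x0;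
rewrite hornerM hornerXsubC.
by field; rewrite gt_eqF ?subxi_gt0.
Qed.

End LaguerreWeights.

(** The first two conjuncts make the third meaningful: [monic_orthogonal] is not its default value
    0, and the quotient is not a division by 0. *)
Theorem mainTheorem10 (R : realType) (alpha xi M : R)
    (halpha : -1 < alpha) (hxi : xi <= 0) (hM : 0 <= M) (n : nat) :
  [/\ exists! T : {poly R}, is_monic_orthogonal (c1 alpha xi M) n.+1 T,
      c1 alpha xi M (laguerre (alpha + 1) n) != 0
    & forall t : R,
        (monic_orthogonal (c1 alpha xi M) n.+1).[t] =
        - (laguerre_sqnorm (alpha + 1) n
             / c1 alpha xi M (laguerre (alpha + 1) n))
        * (1 - (t - xi)
               * c1 alpha xi M (laguerre_kernel (alpha + 1) n t))].
Proof.
have halpha1 : -1 < alpha + 1 by rewrite ltr_wpDr.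
(* Packing the concrete functionals as linear maps makes the abstract results applicable. *)
pose c : {scalar {poly R}} := HB.pack (c1 alpha xi M)
  (GRing.isLinear.Build _ _ _ _ (c1 alpha xi M)
     (@c1_scalar _ _ _ M halpha hxi)).
pose L : {scalar {poly R}} := HB.pack (laguerre_functional (alpha + 1))
  (GRing.isLinear.Build _ _ _ _ (laguerre_functional (alpha + 1))
     (@laguerre_functional_scalar _ _ halpha1)).
have cP : forall p : {poly R}, p != 0 -> 0 < c (p ^+ 2) by exact: c1_gt0.
have LP (p : {poly R}) : p != 0 -> 0 < L (p ^+ 2).
  by exact: laguerre_functional_gt0.
have cL : forall p : {poly R}, c (('X - xi%:P) * p) = L p by exact: c1_mulXsubC.
split.
- exists (monic_orthogonal c n.+1); split; first exact: monic_orthogonalP.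
  by move=> T; apply: (@monic_orthogonal_unique R c cP n.+1);
    exact: monic_orthogonalP.
- exact: (@functional_monic_orthogonal_neq0 _ c L xi).
move=> t; rewrite (@monic_orthogonal_christoffel _ c L xi) //.
rewrite hornerZ !hornerE; congr (_ * (1 - _ * _)).
(* Folding [c1] back into the packed [c] lets linearity in [x] move it inside the kernel sum, which
   is then compared term by term with [K] evaluated at [t]. *)
rewrite -[c1 _ _ _]/(c : _ -> _) /laguerre_kernel linear_sum horner_sum.
by apply: eq_bigr => j _; rewrite linearZ /= hornerZ mulrC mulrAC mulrA.
Qed.
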